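(* Let $0\le\alpha<d$, $1<p\le q<\infty$, $1\le r,s\le\infty$, and let $(u,\sigma)$ be a pair of weights on $\mathbb R^d$. If the operator $f\mapsto M_\alpha(f\sigma)$ is bounded from $L^{p,r}_{\sigma^{1/p}}$ to $L^{q,s}_{u^{1/q}}$, then $(u,\sigma)\in\mathsf A^\alpha_{(p,r),(q,s)}$. If $0<\alpha<d$, the same conclusion follows from the boundedness of $f\mapsto I_\alpha(f\sigma)$ from $L^{p,r}_{\sigma^{1/p}}$ to $L^{q,s}_{u^{1/q}}$.
   Context: A weight is a measurable function on $\mathbb R^d$ with values in $(0,\infty)$ almost everywhere; cubes have sides parallel to the axes. For a measurable $f$ on $\mathbb R^d$ with decreasing rearrangement $f^*$, $\|f\|_{L^{a,b}}:=\big(\frac ba\int_0^\infty[t^{1/a}f^*(t)]^b\frac{dt}t\big)^{1/b}$ for $0<a,b<\infty$, and $\|f\|_{L^{a,\infty}}:=\sup_{t>0}t^{1/a}f^*(t)$. For a weight $w$, $L^{a,b}_w:=\{f: fw\in L^{a,b}(\mathbb R^d)\}$ with $\|f\|_{L^{a,b}_w}:=\|fw\|_{L^{a,b}}$. For a cube $Q$, $\|h\|_{L^{a,b}(Q)}:=|Q|^{-1/a}\|h\mathbf 1_Q\|_{L^{a,b}}$. Primes denote conjugate exponents, $1'=\infty$, $\infty'=1$. The fractional maximal operator is $M_\alpha f(x)=\sup_{Q\ni x}|Q|^{\alpha/d}\frac1{|Q|}\int_Q|f|$ (supremum over cubes containing $x$), and the fractional integral is $I_\alpha f(x)=\int_{\mathbb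 R^d}\frac{f(y)}{|x-y|^{d-\alpha}}\,dy$. The pair $(u,\sigma)$ belongs to $\mathsf A^\alpha_{(p,r),(q,s)}$ if $$\sup_Q|Q|^{\frac\alpha d+\frac1q-\frac1p}\,\|u^{1/q}\|_{L^{q,s}(Q)}\,\|\sigma^{1/p'}\|_{L^{p',r'}(Q)}<\infty.$$ *)

(* Defs.v *)
From HB Require Import structures.
From mathcomp Require Import all_boot all_order all_algebra.
From mathcomp Require Import all_classical all_reals all_analysis measurable_realfun.
Set Implicit Arguments.
Unset Strict Implicit.
Unset Printing Implicit Defensive.
Import Order.TTheory GRing.Theory Num.Theory.
Import numFieldNormedType.Exports.
Local Open Scope classical_set_scope.
Local Open Scope ring_scope.
Local Open Scope ereal_scope.

Section cons_measure.
Variables (R : realType) (n : nat).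
Local Notation T := (measurableTypeR R).

Definition cons_pair (z : T * n.-tuple T) : n.+1.-tuple T :=
  [the n.+1.-tuple T of z.1 :: z.2].

Lemma measurable_cons_pair : measurable_fun [set: T * n.-tuple T] cons_pair.
Proof. exact: measurable_cons. Qed.

Variable m : {sigma_finite_measure set (n.-tuple T) -> \bar R}.

Definition cons_measure : set (n.+1.-tuple T) -> \bar R :=
  pushforward (lebesgue_measure \x m) cons_pair.

Let cons_measure0 : cons_measure set0 = 0.
Proof. by rewrite /cons_measure /pushforward preimage_set0 measure0. Qed.

Let cons_measure_ge0 A : 0 <= cons_measure A.
Proof. exact: (measure_ge0 (lebesgue_measure \x m)). Qed.

Let cons_measure_sigma_additive : semi_sigma_additive cons_measure.
Proof.
move=> F mF tF mUF; rewrite /cons_measure /pushforward preimage_bigcup.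
have mP A : measurable A -> measurable (cons_pair @^-1` A).
  by move=> mA; rewrite -[X in measurable X]setTI; exact: measurable_cons_pair.
apply: measure_semi_sigma_additive.
- by move=> k; exact: mP.
- apply/trivIsetP => /= i j _ _ ij; rewrite -preimage_setI.
  by move/trivIsetP : tF => /(_ _ _ _ _ ij) ->//; rewrite preimage_set0.
- by rewrite -preimage_bigcup; exact: mP.
Qed.

HB.instance Definition _ := isMeasure.Build _ _ _ cons_measure
  cons_measure0 cons_measure_ge0 cons_measure_sigma_additive.

Let cons_measure_sigma_finite : sigma_finite setT cons_measure.
Proof.
have [F TF Foo] : sigma_finite [set: T * n.-tuple T] (lebesgue_measure \x m).
  have /sigma_finiteP[F [TF ndF Foo]] := sigma_finiteT (@lebesgue_measure R).
  have /sigma_finiteP[G [TG ndG Goo]] := sigma_finiteT m.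
  exists (fun k => F k `*` G k).
    rewrite -setXTT TF TG predeqE => -[x y]; split.
      move=> [/= [i _ Fix] [k _ Gky]]; exists (maxn i k) => //; split.
      - by move: x Fix; exact/subsetPset/ndF/leq_maxl.
      - by move: y Gky; exact/subsetPset/ndG/leq_maxr.
    by move=> [i _ []/= ? ?]; split; exists i.
  move=> k; have [? ?] := Foo k; have [? ?] := Goo k.
  split; first exact: measurableX.
  by rewrite product_measure1E// lte_mul_pinfty// ge0_fin_numE.
pose u (t : n.+1.-tuple T) := (thead t, [tuple of behead t]).
have mu : measurable_fun setT u.
  apply/measurable_fun_pairP; split; first exact: measurable_tnth.
  exact: measurable_behead.
have uK z : u (cons_pair z) = z.
  by case: z => a b; congr pair; apply/val_inj.
exists (fun k => u @^-1` F k); first by rewrite -preimage_bigcup -TF preimage_setT.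
move=> k; have [mFk Fk] := Foo k; split.
  by rewrite -[X in measurable X]setTI; exact: mu.
rewrite /cons_measure /pushforward -comp_preimage.
by rewrite (_ : _ \o _ = id)//; apply/funext => z; exact: uK.
Qed.

HB.instance Definition _ := Measure_isSigmaFinite.Build _ _ _ cons_measure
  cons_measure_sigma_finite.

End cons_measure.

(* The n-fold product of the one-dimensional Lebesgue measure, on the Borel
   sigma-algebra of R^n. *)
Fixpoint lebesgue_prod (R : realType) (n : nat) :
    {sigma_finite_measure set (n.-tuple (measurableTypeR R)) -> \bar R} :=
  match n with
  | 0 => \d_([tuple] : 0.-tuple (measurableTypeR R))
  | n.+1 => cons_measure (lebesgue_prod R n)
  end.

Lemma lebesgue_prod_box (R : realType) n
    (A : 'I_n -> set (measurableTypeR R)) :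
  (forall i, measurable (A i)) ->
  lebesgue_prod R n [set x | forall i, A i (tnth x i)] =
  \prod_(i < n) lebesgue_measure (A i).
Proof.
elim: n A => [|n IH] A mA.
  by rewrite big_ord0 /= diracE mem_set// => -[].
rewrite big_ord_recl -IH; last by move=> i; exact: mA.
rewrite /= /cons_measure /pushforward /=.
rewrite -product_measure1E//; last first.
  rewrite (_ : [set x | _] = \bigcap_(i in [set: 'I_n])
      ((fun x : n.-tuple (measurableTypeR R) => tnth x i) @^-1` A (lift ord0 i))).
    apply: fin_bigcap_measurable => // i _.
    rewrite -[X in measurable X]setTI; apply: measurable_tnth => //; exact: mA.
  by apply/seteqP; split => x /= h i; [move=> _; exact: h|exact: (h i I)].
congr (_ _); apply/seteqP; split => -[a b] /=.
- move=> h; split; first exact: (h ord0).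
  by move=> i; have := h (lift ord0 i); rewrite tnthS.
- move=> [h0 h] i; case: (unliftP ord0 i) => [j ->|->] //.
  by rewrite tnthS; exact: h.
Qed.

(* R^d with the Lebesgue sigma-algebra, i.e. the sets that are Caratheodory
   measurable for the outer measure induced by [lebesgue_prod]. *)
Notation euclid R d := (caratheodory_type ((lebesgue_prod R d)^*)%mu).

Definition lebesgue (R : realType) (d : nat) : set (euclid R d) -> \bar R :=
  @completed_measure_extension _ _ _ (lebesgue_prod R d).
HB.instance Definition _ (R : realType) (d : nat) := Measure.on (@lebesgue R d).
Arguments lebesgue : clear implicits.

Section lorentz.
Context {disp : measure_display} {T : measurableType disp} {R : realType}.
Variable mu : {measure set T -> \bar R}.
Implicit Types (f w : T -> \bar R) (a : R) (b : \bar R).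

Definition decreasing_rearrangement f (t : R) : \bar R :=
  ereal_inf [set l%:E | l in
    [set l : R | (0 <= l)%R /\ mu [set x | l%:E < `|f x|] <= t%:E]].

(* Only 0 < a < +oo and 0 < b <= +oo are meaningful; the value at b = -oo is
   junk. *)
Definition lorentz_norm a b f : \bar R :=
  match b with
  | c%:E =>
    ((c / a)%:E * \int[lebesgue_measure]_(t in `]0%R, +oo[)
       (((t `^ a^-1)%:E * decreasing_rearrangement f t) `^ c / t%:E)) `^ c^-1
  | +oo => ereal_sup [set (t `^ a^-1)%:E * decreasing_rearrangement f t |
                       t in `]0%R, +oo[]
  | -oo => 0
  end.

Definition lorentz a b : set (T -> \bar R) :=
  [set f : T -> \bar R | measurable_fun [set: T] f /\ lorentz_norm a b f < +oo].

Definition wlorentz_norm a b w f : \bar R :=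
  lorentz_norm a b (fun x => f x * w x).

Definition wlorentz a b w : set (T -> \bar R) :=
  [set f : T -> \bar R | lorentz a b (fun x => f x * w x)].

Definition lorentz_bounded (Op : (T -> \bar R) -> (T -> \bar R))
    (a1 : R) (b1 : \bar R) (w1 : T -> \bar R)
    (a2 : R) (b2 : \bar R) (w2 : T -> \bar R) : Prop :=
  exists2 C : R, (0 <= C)%R & forall f, wlorentz a1 b1 w1 f ->
    wlorentz a2 b2 w2 (Op f) /\
    wlorentz_norm a2 b2 w2 (Op f) <= C%:E * wlorentz_norm a1 b1 w1 f.

End lorentz.

Section two_weight.
Context {R : realType} {d : nat}.
Local Notation mu := (lebesgue R d).
Implicit Types (f u w sigma : euclid R d -> \bar R) (Q : set (euclid R d)).
Implicit Types (x y : euclid R d).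

Definition weight w : Prop :=
  measurable_fun [set: euclid R d] w /\ {ae mu, forall x, 0 < w x < +oo}.

(* The closed nondegenerate axis-parallel cubes. *)
Definition cube : set (set (euclid R d)) :=
  [set Q | exists (c : d.-tuple R) (l : R), (0 < l)%R /\
    Q = [set x | forall i, (tnth c i <= tnth x i <= tnth c i + l)%R]].

Definition lorentz_norm_on Q (a : R) (b : \bar R) f : \bar R :=
  mu Q `^ (- a^-1) * lorentz_norm mu a b (fun x => f x * (\1_Q x)%:E).

Definition frac_maximal (alpha : R) f x : \bar R :=
  ereal_sup [set mu Q `^ (alpha / d%:R) * ((mu Q)^-1 * \int[mu]_(y in Q) `|f y|) |
              Q in [set Q | cube Q /\ Q x]].

Definition euclid_dist x y : R :=
  Num.sqrt (\sum_(i < d) (tnth x i - tnth y i) ^+ 2)%R.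

(* When the integral of a signed f does not converge absolutely, its value is
   not finite, as (+oo) - (+oo) is -oo in \bar R. *)
Definition frac_integral (alpha : R) f x : \bar R :=
  \int[mu]_y (f y / (euclid_dist x y `^ (d%:R - alpha))%:E).

Definition weight_class (alpha p : R) (r : \bar R) (q : R) (s : \bar R)
    (u sigma : euclid R d -> \bar R) : Prop :=
  let p' := fine (hoelder_conjugate p%:E) in
  let r' := hoelder_conjugate r in
  ereal_sup [set mu Q `^ (alpha / d%:R + q^-1 - p^-1) *
                 lorentz_norm_on Q q s (fun x => u x `^ q^-1) *
                 lorentz_norm_on Q p' r' (fun x => sigma x `^ p'^-1) |
              Q in cube] < +oo.

End two_weight.

(* Main.v *)
Require Import Defs.
From mathcomp Require Import all_boot all_order all_algebra.
From mathcomp Require Import all_classical all_reals all_analysis measurable_realfun.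
From mathcomp Require Import ring lra.
Set Implicit Arguments.
Unset Strict Implicit.
Unset Printing Implicit Defensive.
Import Order.TTheory GRing.Theory Num.Theory.
Import numFieldNormedType.Exports.
Local Open Scope classical_set_scope.
Local Open Scope ring_scope.
Local Open Scope ereal_scope.

(** On a cube Q of side l, both M_alpha F and I_alpha F are bounded below by a
    constant multiple of l^(alpha - d) times the integral of F, for every F >= 0
    supported in Q. Testing the boundedness on F = h sigma^(1/p'), with h
    supported in Q, therefore bounds the functional
    h |-> int h sigma^(1/p') on L^(p,r), and it remains to see that this controls
    the L^(p',r') norm of g = sigma^(1/p') 1_Q, i.e. the converse half of Lorentz
    duality.

    For that half, let E_i = {g > l_i} with l_i = c 2^i, m_i = |E_i|, and take
    h = max_i a_i 1_(E_i) over finitely many i. Because the E_i are nested,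
    h^*(t) <= max {a_i | t < m_i}, so the r-th power of the norm of h is at most
    sum_i a_i^r m_i^(r/p): with a maximum instead of a sum no Hardy inequality is
    needed. Because the l_i are geometric, int h g >= 1/2 sum_i l_i a_i m_i. The
    choice a_i = l_i^(r'-1) m_i^(r'/p'-1) turns both sums into
    sum_i l_i^r' m_i^(r'/p'), which dominates the norm of g up to the
    contribution of {g <= c}; the scale c is chosen so that this contribution is
    of the size of the bound being proved. *)

(** * Integrals and inequalities in the extended reals *)

(* Unlike in [ge0_le_integral], no measurability is assumed. *)
Lemma ge0_le_integralW disp (T : measurableType disp) (R : realType)
    (nu : {measure set T -> \bar R}) (f g : T -> \bar R) :
  (forall x, 0 <= f x) -> (forall x, f x <= g x) ->
  \int[nu]_x f x <= \int[nu]_x g x.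
Proof.
move=> f0 fg; rewrite !ge0_integralTE//; last by move=> x; exact: le_trans (fg x).
apply: le_ereal_sup => _ [h hf <-]; exists h => // x.
exact: le_trans (fg x).
Qed.

Lemma measurable_abs_level disp (T : measurableType disp) (R : realType)
    (f : T -> \bar R) (l : R) :
  measurable_fun [set: T] f -> measurable [set x | l%:E < `|f x|].
Proof.
move=> mf; rewrite -[X in measurable X]setTI; apply: emeasurable_fun_o_infty => //.
exact: measurableT_comp.
Qed.

(** Lets a possibly infinite x be tested through its positive real minorants. If x is infinite,
    large a force y = 0, and the convention 0 * +oo = 0 then gives the claim. *)
Lemma mule_le_fin_approx (R : realType) (x y : \bar R) (c : R) :
  0 <= x -> 0 <= y -> (0 <= c)%R ->
  (forall a : R, (0 < a)%R -> a%:E <= x -> a%:E * y <= c%:E) -> x * y <= c%:E.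
Proof.
case: x => [x| |//] x0 y0 c0 xy.
  by move: x0; rewrite lee_fin le_eqVlt => /predU1P[<-|x0]; [rewrite mul0e|exact: xy].
case: y y0 xy => [y| |//] y0 xy; last by have := xy 1%R ltr01 (leey _); rewrite mul1e.
move: y0; rewrite lee_fin le_eqVlt => /predU1P[<-|y0]; first by rewrite mule0.
have : (((c + 1) / y)%:E * y%:E <= c%:E).
  by apply: xy (leey _); rewrite divr_gt0// ltr_wpDl.
by rewrite -EFinM divfK ?gt_eqF// lee_fin gerDl ler10.
Qed.

Lemma measurable_poweR_indic disp (T : measurableType disp) (R : realType)
    (f : T -> \bar R) (e : R) (A : set T) :
  measurable_fun [set: T] f -> measurable A ->
  measurable_fun [set: T] (fun x => f x `^ e * (\1_A x)%:E).
Proof.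
move=> mf mA; apply: emeasurable_funM.
  exact: (measurableT_comp (measurable_poweR _)).
by apply/measurable_EFinP; exact: measurable_indic.
Qed.

(** For e < 1 the integrand is singular at 0, so the fundamental theorem of calculus is applied on
    [m / (n + 2), m], and monotone convergence passes to the union, which contains []0, m[]. The
    offset 2 keeps the interval nondegenerate for n = 0. *)
Lemma integral_powR_itv0_le (R : realType) (e m : R) : (0 < e)%R ->
  \int[lebesgue_measure]_(t in `]0%R, m[) (e * t `^ (e - 1))%:E <= (m `^ e)%:E.
Proof.
move=> e0; have [m0|m0] := leP m 0%R.
  by rewrite set_itv_ge ?integral_set0 ?lee_fin ?powR_ge0// bnd_simp -leNgt.
pose F n := [set` `[(m / n.+2%:R)%R, m]].
have Fm n : (0 < m / n.+2%:R)%R by rewrite divr_gt0.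
have mf (D : set R) : measurable D -> measurable_fun D (fun t => (e * t `^ (e - 1))%:E).
  move=> mD; apply/measurable_EFinP; apply: measurable_funM => //.
  by apply: measurable_funTS; exact: measurable_powR.
have IF n : \int[lebesgue_measure]_(t in F n) (e * t `^ (e - 1))%:E <= (m `^ e)%:E.
  have lm : (m / n.+2%:R < m)%R by rewrite ltr_pdivrMr// ltr_pMr// ltr1n.
  have dP b x : (0 < x)%R -> derivable (fun t : R => t `^ b)%R x 1.
    by move=> x0; apply: derivable_powR; rewrite in_itv/= x0.
  have cP b x : (0 < x)%R -> {for x, continuous (fun t : R => t `^ b)%R}.
    by move=> x0; apply: differentiable_continuous; apply/derivable1_diffP; exact: dP.
  rewrite (@continuous_FTC2 _ (fun t => e * t `^ (e - 1))%R (fun t => t `^ e)%R)//.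
  - by rewrite -EFinB lee_fin gerBl powR_ge0.
  - apply: continuous_in_subspaceT => x; rewrite inE/= in_itv/= => /andP[x1 _].
    apply: cvgM; first exact: cvg_cst.
    by apply: cP; exact: lt_le_trans x1.
  - split.
    + by move=> x; rewrite in_itv/= => /andP[x1 _]; apply: dP; exact: lt_trans x1.
    + by apply: cvg_at_right_filter; apply: cP.
    + by apply: cvg_at_left_filter; apply: cP.
  - move=> x; rewrite in_itv/= => /andP[x1 _].
    by rewrite powR_derive1// in_itv/= (lt_trans _ x1).
have f0 t : 0 <= (e * t `^ (e - 1))%:E by rewrite lee_fin mulr_ge0 ?powR_ge0// ltW.
have sub : `]0%R, m[ `<=` \bigcup_n F n.
  move=> t; rewrite /= in_itv/= => /andP[t0 tm].
  have [n _ nP] := near_infty_natSinv_lt (PosNum (divr_gt0 t0 m0)).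
  exists n => //=; rewrite /F/= in_itv/= (ltW tm) andbT.
  have := nP n (leqnn n); rewrite /= => h.
  rewrite ltW// mulrC -ltr_pdivlMr//; apply: lt_trans h.
  by rewrite ltf_pV2 ?posrE// ltr_nat.
apply: (@le_trans _ _ (\int[lebesgue_measure]_(t in \bigcup_n F n) (e * t `^ (e - 1))%:E)).
  apply: ge0_subset_integral => //.
  - by apply: bigcup_measurable => n _; exact: measurable_itv.
  - by apply: mf; apply: bigcup_measurable => n _; exact: measurable_itv.
have cvgF := @ge0_nondecreasing_set_cvg_integral _ (measurableTypeR R) R F
  (fun t => (e * t `^ (e - 1))%:E) lebesgue_measure.
apply: cvge_le (cvgF _ _ _ _) => //.
- by apply: nearW => n; exact: IF.
- move=> n k nk; rewrite subsetEset => t; rewrite /F/= !in_itv/= => /andP[h ->].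
  rewrite andbT (le_trans _ h)// ler_pM2l// lef_pV2 ?posrE// ler_nat.
  by rewrite !ltnS.
- by move=> n; exact: measurable_itv.
- by move=> n; apply: mf; exact: measurable_itv.
Qed.

(** * Decreasing rearrangements and Lorentz norms *)

Section rearrangement.
Context {disp : measure_display} {T : measurableType disp} {R : realType}.
Variable mu : {measure set T -> \bar R}.
Implicit Types (f g : T -> \bar R) (t l : R).

Lemma rearrangement_ge0 f t : 0 <= decreasing_rearrangement mu f t.
Proof. by apply: le_ereal_inf_tmp => _ [l [l0 _] <-]; rewrite lee_fin. Qed.

Lemma rearrangement_le f t l : (0 <= l)%R ->
  mu [set x | l%:E < `|f x|] <= t%:E -> decreasing_rearrangement mu f t <= l%:E.
Proof. by move=> l0 fl; apply: ereal_inf_lbound; exists l. Qed.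

Lemma rearrangement_gt f t l : (0 <= l)%R ->
  l%:E < decreasing_rearrangement mu f t -> t%:E < mu [set x | l%:E < `|f x|].
Proof.
by move=> l0; rewrite !ltNge; apply: contra; exact: rearrangement_le.
Qed.

Lemma rearrangement_nonincreasing f t1 t2 : (t1 <= t2)%R ->
  decreasing_rearrangement mu f t2 <= decreasing_rearrangement mu f t1.
Proof.
move=> t12; apply: le_ereal_inf_tmp => _ [l [l0 fl] <-].
by apply: rearrangement_le => //; rewrite (le_trans fl)// lee_fin.
Qed.

(** By monotonicity the superlevel sets are intervals, hence Borel. *)
Lemma measurable_rearrangement f (D : set (measurableTypeR R)) :
  measurable D -> measurable_fun D (decreasing_rearrangement mu f).
Proof.
move=> mD; apply: (measurability _ (ErealGenOInfty.measurableE R)) => // _ [_ [r ->] <-].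
apply: measurableI => //; apply: is_interval_measurable => a b /=.
rewrite !in_itv/= !andbT => _ br z /andP[_ zb].
by rewrite in_itv/= andbT (lt_le_trans br)// rearrangement_nonincreasing.
Qed.

Lemma rearrangement_distribution_le f g t :
  (forall l, (0 <= l)%R ->
    mu [set x | l%:E < `|f x|] <= mu [set x | l%:E < `|g x|]) ->
  decreasing_rearrangement mu f t <= decreasing_rearrangement mu g t.
Proof.
move=> fg; apply: le_ereal_inf_tmp => _ [l [l0 gl] <-].
by apply: rearrangement_le => //; exact: le_trans (fg _ l0) gl.
Qed.

Lemma rearrangement_scale f t (c : R) : (0 < c)%R ->
  c%:E * decreasing_rearrangement mu f t <=
  decreasing_rearrangement mu (fun x => c%:E * f x) t.
Proof.
move=> c0; apply: le_ereal_inf_tmp => _ [l [l0 fl] <-].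
rewrite muleC -lee_pdivlMr// -EFinM; apply: rearrangement_le.
  by rewrite divr_ge0// ltW.
apply: le_trans fl; rewrite le_eqVlt; apply/orP; left; apply/eqP; congr (mu _).
apply/funext => x /=; rewrite abseM (@gee0_abs _ c%:E) ?lee_fin ?ltW//.
by rewrite EFinM lte_pdivrMr// muleC.
Qed.

Lemma measurable_powR_rearrangement f (k e c : R) (D : set (measurableTypeR R)) :
  measurable D -> measurable_fun D (fun t : measurableTypeR R =>
    (k * t `^ e)%:E * decreasing_rearrangement mu f t `^ c).
Proof.
move=> mD; apply: emeasurable_funM.
  apply/measurable_EFinP; apply: measurable_funM => //.
  by apply: measurable_funTS; exact: measurable_powR.
by apply: (measurableT_comp (measurable_poweR c)); exact: measurable_rearrangement.
Qed.

(** In this form the weight (c / a) t^(c / a - 1) is the derivative of t^(c / a), so a layer of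
    height 1 over []0, m[] contributes m^(c / a). *)
Lemma lorentz_norm_finE (a c : R) f : (0 < a)%R -> (0 < c)%R ->
  lorentz_norm mu a c%:E f =
  (\int[lebesgue_measure]_(t in `]0%R, +oo[)
    ((c / a * t `^ (c / a - 1))%:E * decreasing_rearrangement mu f t `^ c)) `^ c^-1.
Proof.
move=> a0 c0; congr (_ `^ _).
under [RHS]eq_integral do rewrite EFinM -muleA.
rewrite ge0_integralZl_EFin//; last 3 first.
- by move=> t _; rewrite mule_ge0 ?poweR_ge0// lee_fin powR_ge0.
- apply: eq_measurable_fun; last first.
    by apply: (measurable_powR_rearrangement f 1 (c / a - 1) c); exact: measurable_itv.
  by move=> t _; rewrite mul1r.
- by rewrite divr_ge0// ltW.
congr (_ * _); apply: eq_integral => t; rewrite inE/= in_itv/= andbT => t0.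
rewrite poweRM ?lee_fin ?powR_ge0 ?rearrangement_ge0// poweR_EFin inver gt_eqF//.
rewrite muleAC -EFinM; congr (_%:E * _).
by rewrite -powRrM (mulrC _ c) powRD ?(gt_eqF t0) ?implybT// powR_inv1// ltW.
Qed.

(** Common source of the monotonicity of the norm (with c = 1) and of its behaviour under
    scaling. *)
Lemma lorentz_norm_scale_le (a : R) (b : \bar R) (c : R) f g :
  (0 < a)%R -> 0 < b -> (0 < c)%R ->
  (forall t, (0 < t)%R ->
    c%:E * decreasing_rearrangement mu f t <= decreasing_rearrangement mu g t) ->
  c%:E * lorentz_norm mu a b f <= lorentz_norm mu a b g.
Proof.
move=> a0; case: b => [b| |//] b0 c0 fg.
  rewrite lte_fin in b0; have ba0 : (0 <= b / a)%R by rewrite divr_ge0// ltW.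
  have k0 t : (0 <= b / a * t `^ (b / a - 1))%R by rewrite mulr_ge0// powR_ge0.
  have int_ge0 h D : 0 <= \int[lebesgue_measure]_(t in D)
      ((b / a * t `^ (b / a - 1))%:E * decreasing_rearrangement mu h t `^ b).
    by apply: integral_ge0 => t _; rewrite mule_ge0 ?poweR_ge0// lee_fin.
  rewrite !lorentz_norm_finE//.
  (* The factor c moves under the outer power, which leaves a comparison of two integrals. *)
  have -> : c%:E = (c%:E `^ b) `^ b^-1.
    by rewrite -poweRrM divff ?gt_eqF// poweRe1// lee_fin ltW.
  rewrite -poweRM ?poweR_ge0//.
  apply: gt0_ler_poweR; rewrite ?invr_ge0 ?(ltW b0)// ?in_itv/= ?leey
    ?mule_ge0 ?lee_fin ?powR_ge0 ?int_ge0//.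
  rewrite -ge0_integralZl_EFin//.
  - apply: ge0_le_integral => //.
    + move=> t _; rewrite mule_ge0 ?lee_fin ?powR_ge0//.
      by rewrite mule_ge0 ?poweR_ge0// lee_fin.
    + apply: measurable_funeM; apply: measurable_powR_rearrangement.
      exact: measurable_itv.
    + by apply: measurable_powR_rearrangement; exact: measurable_itv.
    + move=> t; rewrite /= in_itv/= andbT => t0; rewrite muleCA.
      rewrite lee_wpmul2l ?lee_fin// -poweR_EFin -poweRM ?rearrangement_ge0//; last first.
        by rewrite lee_fin ltW.
      apply: gt0_ler_poweR; rewrite ?(ltW b0)// ?in_itv/= ?leey ?andbT ?rearrangement_ge0//.
        by rewrite mule_ge0 ?rearrangement_ge0// lee_fin ltW.
      exact: fg.
  - by move=> t _; rewrite mule_ge0 ?poweR_ge0// lee_fin.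
  - by apply: measurable_powR_rearrangement; exact: measurable_itv.
  - by rewrite powR_ge0.
rewrite muleC -lee_pdivlMr//; apply/ereal_supP => _ [t t0 <-].
rewrite lee_pdivlMr//; apply: (@le_trans _ _
  ((t `^ a^-1)%:E * decreasing_rearrangement mu g t)).
  rewrite muleC muleCA lee_wpmul2l ?lee_fin ?powR_ge0//.
  by move: t0; rewrite /= in_itv/= andbT; exact: fg.
by apply: ereal_sup_ubound; exists t.
Qed.

Lemma lorentz_norm_le (a : R) (b : \bar R) f g : (0 < a)%R -> 0 < b ->
  (forall l, (0 <= l)%R ->
    mu [set x | l%:E < `|f x|] <= mu [set x | l%:E < `|g x|]) ->
  lorentz_norm mu a b f <= lorentz_norm mu a b g.
Proof.
move=> a0 b0 fg; rewrite -[leLHS]mul1e; apply: lorentz_norm_scale_le => // t t0.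
by rewrite mul1e; exact: rearrangement_distribution_le.
Qed.

Lemma lorentz_normZ_le (a : R) (b : \bar R) (c : R) f : (0 < a)%R -> 0 < b ->
  (0 < c)%R ->
  c%:E * lorentz_norm mu a b f <= lorentz_norm mu a b (fun x => c%:E * f x).
Proof.
move=> a0 b0 c0; apply: lorentz_norm_scale_le => // t _.
exact: rearrangement_scale.
Qed.

Lemma lorentz_norm_ge0 (a : R) (b : \bar R) f : 0 <= lorentz_norm mu a b f.
Proof.
case: b => [b| |//]; first exact: poweR_ge0.
apply: le_trans (ereal_sup_ubound (_ : [set _ | t in _]
  ((1 `^ a^-1)%:E * decreasing_rearrangement mu f 1))).
  by rewrite mule_ge0 ?rearrangement_ge0// lee_fin powR_ge0.
by exists 1%R => //=; rewrite in_itv/= ltr01.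
Qed.

(** If the c-th power of the rearrangement lies below a sum of layers of height b_i over []0, m_i[],
    termwise integration bounds the c-th power of the norm by the sum of the b_i m_i^(c / a). *)
Lemma lorentz_norm_fin_le (a c : R) f (b m : nat -> R) (S : R) :
  (0 < a)%R -> (0 < c)%R -> (forall i, 0 <= b i)%R ->
  (forall t, (0 < t)%R -> decreasing_rearrangement mu f t `^ c <=
    \sum_(0 <= i <oo) (b i * (t < m i)%R%:R)%:E) ->
  (forall n, \sum_(0 <= i < n) b i * m i `^ (c / a) <= S)%R ->
  lorentz_norm mu a c%:E f <= (S `^ c^-1)%:E.
Proof.
move=> a0 c0 b0 fb bS; rewrite lorentz_norm_finE// -poweR_EFin.
have S0 : (0 <= S)%R by have := bS 0%N; rewrite big_geq.
have ca0 : (0 < c / a)%R by rewrite divr_gt0.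
have k0 t : (0 <= c / a * t `^ (c / a - 1))%R by rewrite mulr_ge0 ?powR_ge0// ltW.
have u0 i t : 0 <= (b i * (t < m i)%R%:R)%:E by rewrite lee_fin mulr_ge0.
apply: gt0_ler_poweR; rewrite ?invr_ge0 ?(ltW c0)// ?in_itv/= ?leey ?lee_fin ?S0//.
  by rewrite andbT; apply: integral_ge0 => t _; rewrite mule_ge0 ?poweR_ge0// lee_fin.
pose F i (t : measurableTypeR R) :=
  (c / a * t `^ (c / a - 1))%:E * (b i * (t < m i)%R%:R)%:E.
have mk : measurable_fun [set: measurableTypeR R]
    (fun t : measurableTypeR R => (c / a * t `^ (c / a - 1))%:E).
  by apply/measurable_EFinP; apply: measurable_funM => //; exact: measurable_powR.
have mI i : measurable_fun [set: measurableTypeR R]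
    (fun t : measurableTypeR R => (b i * (t < m i)%R%:R)%:E).
  apply/measurable_EFinP; apply: measurable_funM => //.
  rewrite (_ : (fun _ => _) = \1_`]-oo, m i[); last first.
    by apply/funext => t; rewrite indicE mem_setE in_itv.
  exact: measurable_indic.
have mF i : measurable_fun (`]0%R, +oo[ : set (measurableTypeR R)) (F i).
  by apply: measurable_funTS; exact: emeasurable_funM.
have F0 i t : 0 <= F i t by rewrite mule_ge0// lee_fin.
apply: (@le_trans _ _ (\int[lebesgue_measure]_(t in `]0%R, +oo[)
    \sum_(0 <= i <oo) F i t)).
  apply: ge0_le_integral => //.
  - by move=> t _; rewrite mule_ge0 ?poweR_ge0// lee_fin.
  - by apply: measurable_powR_rearrangement; exact: measurable_itv.
  - by apply: ge0_emeasurable_sum => // i t _ _; exact: F0.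
  - move=> t; rewrite /= in_itv/= andbT => t0.
    by rewrite nneseriesZl// lee_wpmul2l ?lee_fin//; exact: fb.
rewrite integral_nneseries//.
apply: lime_le; first by apply: is_cvg_nneseries => i _ _; exact: integral_ge0.
apply: nearW => n; apply: (@le_trans _ _ (\sum_(0 <= i < n) (b i * m i `^ (c / a))%:E)); last first.
  by rewrite sumEFin lee_fin.
apply: lee_sum => i _.
(* The indicator of t < m_i is absorbed into the domain of integration. *)
have -> : \int[lebesgue_measure]_(t in `]0%R, +oo[) F i t =
    (b i)%:E * \int[lebesgue_measure]_(t in `]0%R, m i[) (c / a * t `^ (c / a - 1))%:E.
  rewrite -ge0_integralZl_EFin//; last 2 first.
  - by move=> t _; rewrite lee_fin.
  - by apply: measurable_funTS.
  rewrite [LHS]integral_mkcond [RHS]integral_mkcond.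
  apply: eq_integral => t _; rewrite /patch /F !mem_setE !in_itv/= andbT.
  by case: (0 < t)%R => //=; case: (t < m i)%R; rewrite ?mulr1 ?mulr0 ?mule0// muleC.
by rewrite EFinM lee_wpmul2l ?lee_fin//; exact: integral_powR_itv0_le.
Qed.

End rearrangement.

(** * Dyadic level sets and the converse half of Lorentz duality *)

(** If the last term c 2^n is below y, all earlier terms together add at most c 2^n, hence less than
    y; otherwise the last term contributes nothing and the induction hypothesis applies. *)
Lemma sum_geometric_lt (R : realType) (c y : R) n : (0 <= c)%R -> (0 <= y)%R ->
  (\sum_(0 <= i < n) c * 2 ^+ i * (c * 2 ^+ i < y)%R%:R <= 2 * y)%R.
Proof.
move=> c0 y0; elim: n => [|n IH]; first by rewrite big_geq// mulr_ge0.
rewrite big_nat_recr//=; case: ltP => [ny|_]; last by rewrite mulr0 addr0.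
have : (\sum_(0 <= i < n) c * 2 ^+ i * (c * 2 ^+ i < y)%R%:R <= c * 2 ^+ n)%R.
  elim: n {IH ny} => [|n IH]; first by rewrite big_geq// mulr_ge0.
  rewrite big_nat_recr//= exprS mulrCA mulr_natl mulr2n lerD//.
  by rewrite ler_piMr ?lern1 ?leq_b1// mulr_ge0 ?exprn_ge0.
by move: ny; rewrite mulr1; set S := (\sum_(_ <= _ < _) _)%R; lra.
Qed.

Lemma measurable_bigmaxr (disp : measure_display) (T : measurableType disp)
    (R : realType) (F : nat -> T -> R) n :
  (forall i, measurable_fun [set: T] (F i)) ->
  measurable_fun [set: T] (fun x => \big[Num.max/0%R]_(i < n) F i x).
Proof.
elim: n F => [|k IH] F mF.
  by under eq_fun do rewrite big_ord0; exact: measurable_cst.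
under eq_fun do rewrite big_ord_recl/=.
by apply: measurable_maxr => //; apply: (IH (fun i => F i.+1)) => i; exact: mF.
Qed.

Section duality.
Context {disp : measure_display} {T : measurableType disp} {R : realType}.
Variable mu : {measure set T -> \bar R}.
Variable g : T -> R.
Hypothesis mg : measurable_fun [set: T] g.
Hypothesis g0 : forall x, (0 <= g x)%R.
Hypothesis goo : mu [set x | (0 < g x)%R] < +oo.

(** Distribution function of g; by [goo], [fine] loses nothing for l >= 0. *)
Let dist (l : R) : R := fine (mu [set x | (l < g x)%R]).

Let measurable_level l : measurable [set x | (l < g x)%R].
Proof.
rewrite -[X in measurable X]setTI (_ : [set x | _] = g @^-1` `]l, +oo[); last first.
  by apply/seteqP; split => x /=; rewrite in_itv/= andbT.
by apply: mg => //; exact: measurable_itv.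
Qed.

Let le_level l1 l2 : (l1 <= l2)%R ->
  mu [set x | (l2 < g x)%R] <= mu [set x | (l1 < g x)%R].
Proof.
move=> l12; apply: le_measure; [by rewrite inE; exact: measurable_level..|].
by move=> x /=; exact: le_lt_trans.
Qed.

Let distE l : (0 <= l)%R -> mu [set x | (l < g x)%R] = (dist l)%:E.
Proof.
by move=> l0; rewrite fineK// ge0_fin_numE// (le_lt_trans (le_level l0)).
Qed.

Let dist_ge0 l : (0 <= dist l)%R. Proof. exact: fine_ge0. Qed.

Let level_absE l : [set x | l%:E < `|(g x)%:E|] = [set x | (l < g x)%R].
Proof. by apply/funext => x /=; rewrite lte_fin ger0_norm. Qed.

Section test_function.
Variables (lam a : nat -> R) (n : nat).
Hypothesis lam_gt0 : forall i, (0 < lam i)%R.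
Hypothesis lam_homo : {homo lam : i j / (i <= j)%N >-> (i <= j)%R}.
Hypothesis a0 : forall i, (0 <= a i)%R.

(** Kept abstract in P because the same maximum gives the test function at x (P i: x lies in the
    i-th level set) and the bound for its rearrangement at t (P i: that set has measure above t). *)
Definition level_max (P : nat -> bool) : R :=
  \big[Num.max/0%R]_(i < n) (a i * (P i)%:R)%R.

Lemma level_max_ge0 P : (0 <= level_max P)%R.
Proof.
rewrite /level_max; elim/big_ind : _ => // [x y x0 y0|i _]; last exact: mulr_ge0.
by rewrite le_max x0.
Qed.

Lemma level_max_ge (P : nat -> bool) i : (i < n)%N -> P i -> (a i <= level_max P)%R.
Proof.
move=> ni Pi; rewrite /level_max (bigmaxD1 (Ordinal ni))//= Pi mulr1.
by rewrite le_max lexx.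
Qed.

Lemma level_maxP (P : nat -> bool) : level_max P = 0%R \/
  exists i, [/\ (i < n)%N, P i & level_max P = a i].
Proof.
rewrite /level_max; elim/big_ind : _ => [|x y Hx Hy|i _]; first by left.
  by rewrite /Order.max; case: ifP.
case: (boolP (P i)) => Pi; last by rewrite mulr0; left.
by rewrite mulr1; right; exists i.
Qed.

Definition test_fun x : R := level_max (fun i => lam i < g x)%R.

Lemma measurable_test_fun : measurable_fun [set: T] test_fun.
Proof.
rewrite /test_fun /level_max.
have mI i : measurable_fun [set: T] (fun x => a i * (lam i < g x)%R%:R)%R.
  apply: measurable_funM => //.
  rewrite (_ : (fun _ => _) = \1_[set x | (lam i < g x)%R]); last first.
    by apply/funext => x; rewrite indicE mem_setE.
  exact: measurable_indic.
exact: (measurable_bigmaxr (F := fun i x => a i * (lam i < g x)%R%:R)%R).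
Qed.

Lemma test_fun_eq0 x : g x = 0%R -> test_fun x = 0%R.
Proof.
move=> gx; have [//|[i [_ + _]]] := level_maxP (fun i => lam i < g x)%R.
by rewrite gx ltNge (ltW (lam_gt0 i)).
Qed.

Lemma rearrangement_test_fun t : (0 <= t)%R ->
  decreasing_rearrangement mu (EFin \o test_fun) t <=
  (level_max (fun i => t < dist (lam i))%R)%:E.
Proof.
move=> t0; set l := level_max _; have l0 : (0 <= l)%R by exact: level_max_ge0.
apply: rearrangement_le => //.
(* The value at such an x is some a_i > l. This a_i cannot have entered the maximum l, so the i-th
   level set has measure at most t. *)
have lP x : l%:E < `|(test_fun x)%:E| ->
    exists i, [/\ (i < n)%N, (lam i < g x)%R & (dist (lam i) <= t)%R].
  rewrite /= lte_fin ger0_norm; last exact: level_max_ge0.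
  rewrite /test_fun.
  have [->|[i [ni gi ->]]] := level_maxP (fun i => lam i < g x)%R.
    by rewrite ltNge l0.
  move=> lai; exists i; split => //; rewrite leNgt; apply: contraL lai => ti.
  by rewrite -leNgt; exact: level_max_ge.
have [[i0 [ni0 ti0]]|noti] := pselect (exists i, (i < n)%N /\ (dist (lam i) <= t)%R).
  have exi : exists i, (i < n)%N && (dist (lam i) <= t)%R.
    by exists i0; rewrite ni0.
  (* The level sets decrease, so {test_fun > l} is contained in the one of least
     index among those of measure at most t. *)
  case: (ex_minnP exi) => j /andP[nj tj] jmin.
  rewrite (@le_trans _ _ (dist (lam j))%:E)// -distE ?(ltW (lam_gt0 j))//.
  apply: le_measure.
  - rewrite inE; apply: measurable_abs_level.
    by apply/measurable_EFinP; exact: measurable_test_fun.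
  - by rewrite inE; exact: measurable_level.
  - move=> x /= /lP[i [ni gi ti]]; apply: le_lt_trans gi; apply: lam_homo.
    by apply: jmin; rewrite ni.
rewrite (_ : [set x | _] = set0) ?measure0//.
by apply/seteqP; split => // x /= /lP[i [ni _ ti]]; apply: noti; exists i.
Qed.

(** The maximum bounding the rearrangement is 0 or attained at one index, so its r-th power is at
    most a single term of the sum of layers. *)
Lemma lorentz_norm_test_fun (p r : R) : (0 < p)%R -> (0 < r)%R ->
  lorentz_norm mu p r%:E (EFin \o test_fun) <=
  ((\sum_(0 <= i < n) a i `^ r * dist (lam i) `^ (r / p)) `^ r^-1)%:E.
Proof.
(* The finite family is extended by 0 to a series; partial sums of any length are then compared with
   the one of length n. *)
move=> p0 r0; pose b i := (if (i < n)%N then a i `^ r else 0)%R.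
have b0 i : (0 <= b i)%R by rewrite /b; case: ifP; rewrite ?powR_ge0.
apply: (lorentz_norm_fin_le p0 r0 (b := b) (m := fun i => dist (lam i))) => //.
  move=> t t0; have := rearrangement_test_fun (ltW t0).
  have [->|[i [ni ti ->]]] := level_maxP (fun i => t < dist (lam i))%R => h.
    have -> : decreasing_rearrangement mu (EFin \o test_fun) t = 0.
      by apply/eqP; rewrite eq_le h rearrangement_ge0.
    rewrite poweR0r ?gt_eqF//; apply: nneseries_ge0 => i _ _.
    by rewrite lee_fin mulr_ge0.
  apply: le_trans (nneseries_lim_ge i.+1 _); last by move=> j _ _; rewrite lee_fin mulr_ge0.
  rewrite big_nat_recr//= ti mulr1 {2}/b ni -poweR_EFin; apply: lee_paddl.
    by apply: sume_ge0 => j _; rewrite lee_fin mulr_ge0.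
  by apply: gt0_ler_poweR; rewrite ?(ltW r0)// ?in_itv/= ?leey ?andbT ?rearrangement_ge0// lee_fin.
move=> k; have sum_homo k1 k2 : (k1 <= k2)%N ->
    (\sum_(0 <= i < k1) b i * dist (lam i) `^ (r / p) <=
     \sum_(0 <= i < k2) b i * dist (lam i) `^ (r / p))%R.
  move=> k12; rewrite (big_cat_nat (n := k1) (leq0n _) k12)//= lerDl.
  by apply: sumr_ge0 => i _; rewrite mulr_ge0 ?powR_ge0.
apply: le_trans (sum_homo _ _ (leq_maxl k n)) _.
rewrite (big_cat_nat (n := n) (leq0n _) (leq_maxr k n))//= [X in (_ + X)%R]big_nat_cond.
rewrite [X in (_ + X)%R]big1 ?addr0; last first.
  by move=> i; rewrite andbT => /andP[ni _]; rewrite /b ltnNge ni mul0r.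
by apply: ler_sum_nat => i /andP[_ ni]; rewrite /b ni.
Qed.

(** If the maximum at t is attained at i, then t is below the measure of the i-th level set, so
    t^(1/p) a_i is at most the quantity bounded by A. *)
Lemma lorentz_normy_test_fun (p A : R) : (0 < p)%R -> (0 <= A)%R ->
  (forall i, (i < n)%N -> a i * dist (lam i) `^ p^-1 <= A)%R ->
  lorentz_norm mu p +oo (EFin \o test_fun) <= A%:E.
Proof.
move=> p0 A0 aA; apply/ereal_supP => _ [t + <-]; rewrite /= in_itv/= andbT => t0.
apply: le_trans (lee_wpmul2l _ (rearrangement_test_fun (ltW t0))) _.
  by rewrite lee_fin powR_ge0.
rewrite -EFinM lee_fin.
have [->|[i [ni ti ->]]] := level_maxP (fun i => t < dist (lam i))%R.
  by rewrite mulr0.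
rewrite mulrC (le_trans _ (aA _ ni))// ler_wpM2l//.
by apply: ge0_ler_powR; rewrite ?invr_ge0 ?nnegrE// ltW.
Qed.

End test_function.

(** Pointwise, every a_i with c 2^i < g(x) is at most h(x), where h is the test function, and these
    c 2^i sum to at most 2 g(x). So the sum of the c 2^i a_i over these i is at most 2 h(x) g(x),
    and integration gives the claim. *)
Lemma integral_test_fun (c : R) (a : nat -> R) n : (0 < c)%R ->
  (forall i, 0 <= a i)%R ->
  ((\sum_(0 <= i < n) c * 2 ^+ i * a i * dist (c * 2 ^+ i)) / 2)%:E <=
  \int[mu]_x (test_fun (fun i => c * 2 ^+ i) a n x * g x)%:E.
Proof.
move=> c0 a0; have lam0 i : (0 <= c * 2 ^+ i :> R)%R by rewrite mulr_ge0 ?exprn_ge0// ltW.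
pose I i x : R := (c * 2 ^+ i < g x)%R%:R.
have mI i : measurable_fun [set: T] (I i).
  rewrite (_ : I i = \1_[set x | (c * 2 ^+ i < g x)%R]); last first.
    by apply/funext => x; rewrite indicE mem_setE.
  exact: measurable_indic.
have k0 i : (0 <= c * 2 ^+ i * a i / 2)%R.
  by apply: divr_ge0 => //; exact: mulr_ge0.
have -> : ((\sum_(0 <= i < n) c * 2 ^+ i * a i * dist (c * 2 ^+ i)) / 2)%:E =
    \int[mu]_x \sum_(0 <= i < n) ((c * 2 ^+ i * a i / 2) * I i x)%:E.
  rewrite ge0_integral_sum//; last 2 first.
  - by move=> i; apply/measurable_EFinP; exact: measurable_funM.
  - by move=> i x _; rewrite lee_fin mulr_ge0.
  rewrite mulr_suml -sumEFin; apply: eq_bigr => i _.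
  under eq_integral do rewrite EFinM.
  rewrite ge0_integralZl_EFin//; last 2 first.
  - by move=> x _; rewrite lee_fin.
  - exact/measurable_EFinP.
  rewrite (_ : (fun _ => _) = (fun x => (\1_[set x | (c * 2 ^+ i < g x)%R] x)%:E)); last first.
    by apply/funext => x; rewrite indicE mem_setE.
  by rewrite integral_indic// setIT distE// -EFinM mulrAC.
apply: ge0_le_integral => //.
- by move=> x _; apply: sume_ge0 => i _; rewrite lee_fin mulr_ge0.
- by apply: emeasurable_sum => i; apply/measurable_EFinP; exact: measurable_funM.
- by apply/measurable_EFinP; apply: measurable_funM => //; exact: measurable_test_fun.
- move=> x _; rewrite sumEFin lee_fin.
  have h0 := level_max_ge0 n a0 (fun i => c * 2 ^+ i < g x)%R.
  have := ler_wpM2l h0 (sum_geometric_lt n (ltW c0) (g0 x)).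
  rewrite -/(test_fun (fun i => c * 2 ^+ i) a n x)%R.
  set h := test_fun _ _ _ _ => h2.
  rewrite -(@ler_pM2l _ 2)// (mulrCA 2%R); apply: le_trans h2.
  rewrite !mulr_sumr; apply: ler_sum_nat => i /andP[_ ni].
  rewrite /I; case: (boolP (c * 2 ^+ i < g x)%R) => gi; last by rewrite !mulr0.
  rewrite !mulr1 (mulrC 2%R) divfK ?pnatr_eq0// mulrC ler_wpM2r//.
  by apply: level_max_ge => //.
Qed.


(** Let j be least with g^*(t) <= c 2^j. For j > 0 the level c 2^(j-1) is exceeded, so t is below
    its distribution; for j = 0, t is below the measure of the support. Thus layers bound g^*; the
    choice of c makes layer 0 at most (4 B)^s, and the hypothesis bounds the rest by (4 B)^s. *)
Lemma lorentz_norm_fin_dyadic_le (p s B : R) : (0 < p)%R -> (1 <= s)%R -> (0 < B)%R ->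
  (forall c n, (0 < c)%R ->
    \sum_(0 <= i < n) (c * 2 ^+ i) `^ s * dist (c * 2 ^+ i) `^ (s / p) <=
      (2 * B) `^ s)%R ->
  lorentz_norm mu p s%:E (EFin \o g) <= (8 * B)%:E.
Proof.
move=> p0 s1 B0 gB; have s0 : (0 < s)%R by rewrite (lt_le_trans ltr01).
set M := dist 0; have M0 : (0 <= M)%R by exact: dist_ge0.
(* M + 1 rather than M, to cover the case M = 0. *)
pose c := (4 * B / (M + 1) `^ p^-1)%R.
have c0 : (0 < c)%R by rewrite divr_gt0 ?mulr_gt0 ?powR_gt0// ltr_wpDl.
pose lam i := (c * 2 ^+ i)%R.
have lam0 i : (0 < lam i)%R by rewrite mulr_gt0 ?exprn_gt0.
pose b i := (lam i `^ s)%R.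
(* Shifted by one: the layer of height [lam i] has the width of the level set one step lower, and
   layer 0 that of the support. *)
pose m i := if i is j.+1 then dist (lam j) else M.
have -> : (8 * B)%R = (((8 * B) `^ s) `^ s^-1)%R.
  by rewrite -powRrM divff ?gt_eqF// powRr1// mulr_ge0// ltW.
apply: (lorentz_norm_fin_le p0 s0 (b := b) (m := m)) => [i|t t0|[|n]].
- exact: powR_ge0.
- set y := decreasing_rearrangement _ _ _; set S := \sum_(_ <= _ <oo) _.
  have bm0 j : 0 <= (b j * (t < m j)%R%:R)%:E by rewrite lee_fin mulr_ge0 ?powR_ge0.
  have termS i : (b i * (t < m i)%R%:R)%:E <= S.
    apply: le_trans (nneseries_lim_ge i.+1 _) => [|j _ _]; last exact: bm0.
    by rewrite big_nat_recr//= lee_paddl//; exact: sume_ge0.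
  have y_gt l : (0 <= l)%R -> l%:E < y -> (t < dist l)%R.
    move=> l0 /(rearrangement_gt l0); rewrite -lte_fin -distE//.
    by rewrite [X in mu X](_ : _ = [set x | (l < g x)%R])// -level_absE.
  (* Stated for real z below y, so that it also serves when y is +oo. *)
  have zS z : (0 < z)%R -> z%:E <= y -> (z `^ s)%:E <= S.
    move=> z0 zy.
    have exj : exists j, (z <= lam j)%R.
      exists (Num.bound (z / c)); rewrite /lam mulrC -ler_pdivrMr//.
      have zc0 : (0 <= z / c)%R by rewrite divr_ge0 ?ltW.
      rewrite (le_trans (ltW (archi_boundP zc0)))// -natrX ler_nat.
      by rewrite ltnW// ltn_expl.
    case: (ex_minnP exj) => j zj jmin.
    apply: le_trans (termS j); rewrite lee_fin.
    have -> : (t < m j)%R.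
      case: j zj jmin => [|j] zj jmin; rewrite /m; apply: y_gt => //.
      - by rewrite (lt_le_trans _ zy)// lte_fin.
      - exact: ltW.
      - rewrite (lt_le_trans _ zy)// lte_fin ltNge; apply/negP => /jmin.
        by rewrite ltnn.
    by rewrite mulr1; apply: ge0_ler_powR; rewrite ?nnegrE// ltW.
  have : 0 <= y by exact: rearrangement_ge0.
  case: y y_gt zS => [y| |//] _ zS y0.
    move: y0; rewrite lee_fin le_eqVlt => /predU1P[<-|y0].
      by rewrite poweR0r ?gt_eqF//; exact: nneseries_ge0.
    by rewrite poweR_EFin; exact: zS.
  (* For y = +oo, arbitrarily large z >= 1 satisfy z <= z^s because s >= 1, so the series
     diverges. *)
  rewrite poweRyr ?gt_eqF// leye_eq; apply/eqP; apply: eq_infty => r.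
  have r1 : (1 <= Num.max r 1)%R by rewrite le_max lexx orbT.
  apply: le_trans (zS (Num.max r 1)%R _ _); rewrite ?leey ?(lt_le_trans ltr01)//.
  rewrite lee_fin (@le_trans _ _ (Num.max r 1%R))// ?le_max ?lexx//.
  rewrite -[leLHS]powRr1 ?(le_trans ler01)//.
  by rewrite ler_powR.
- by rewrite big_geq// powR_ge0.
have t1 : (b 0%N * m 0%N `^ (s / p) <= (4 * B) `^ s)%R.
  rewrite /b /lam /m expr0 mulr1 (mulrC s) powRrM -powRM ?(ltW c0) ?powR_ge0//.
  apply: ge0_ler_powR; rewrite ?nnegrE ?(ltW s0) ?mulr_ge0 ?invr_ge0 ?powR_ge0 ?(ltW B0)//.
  rewrite /c mulrAC ler_pdivrMr ?powR_gt0 ?ltr_wpDl// ler_wpM2l//.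
    by rewrite mulr_ge0// ltW.
  by apply: ge0_ler_powR; rewrite ?nnegrE ?invr_ge0 ?lerDl ?addr_ge0// ltW.
have t2 : (\sum_(0 <= i < n) b i.+1 * m i.+1 `^ (s / p) <= (4 * B) `^ s)%R.
  have -> : (4 * B = 2 * (2 * B))%R by ring.
  rewrite (powRM s (_ : 0 <= 2)%R)//; last by rewrite mulr_ge0// ltW.
  apply: le_trans (ler_wpM2l (powR_ge0 _ _) (gB c n c0)).
  rewrite mulr_sumr; apply: ler_sum => i _; rewrite /b /lam /m exprS mulrCA.
  by rewrite (powRM s (_ : 0 <= 2)%R) ?mulrA// (ltW (lam0 i)).
rewrite big_nat_recl//; apply: le_trans (lerD t1 t2) _.
have -> : (8 * B = 2 * (4 * B))%R by ring.
rewrite [leRHS]powRM//; last by rewrite mulr_ge0// ltW.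
(* Here s >= 1 lets the two contributions (4 B)^s add up to at most (8 B)^s. *)
have : (2 <= 2 `^ s :> R)%R by rewrite -[leLHS]powRr1// ler_powR// ler1n.
move/(ler_wpM2r (powR_ge0 (4 * B) s)); apply: le_trans.
by rewrite [leRHS]mulr_natl mulr2n.
Qed.

(** Were g^*(t) above c = 2 B / t^(1/p), the level set at c would have measure above t, and the
    hypothesis would fail at this c. *)
Lemma lorentz_normy_dyadic_le (p B : R) : (0 < p)%R -> (0 < B)%R ->
  (forall c, (0 < c)%R -> c * dist c `^ p^-1 <= 2 * B)%R ->
  lorentz_norm mu p +oo (EFin \o g) <= (2 * B)%:E.
Proof.
move=> p0 B0 gB; apply/ereal_supP => _ [t + <-]; rewrite /= in_itv/= andbT => t0.
have tp : (0 < t `^ p^-1)%R by exact: powR_gt0.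
have c0 : (0 < 2 * B / t `^ p^-1)%R by rewrite divr_gt0 ?mulr_gt0.
rewrite muleC -lee_pdivlMr//; apply: rearrangement_le; first exact: ltW.
rewrite level_absE distE ?(ltW c0)// lee_fin leNgt; apply/negP => tc.
have := gB _ c0; rewrite leNgt => /negP; apply.
rewrite mulrAC ltr_pdivlMr// ltr_pM2l ?mulr_gt0//.
by apply: gt0_ltr_powR; rewrite ?nnegrE ?invr_gt0// ?ltW// (lt_trans t0).
Qed.


(** The pairing is tested through real minorants J, so it may be infinite a priori. Restricting to h
    that vanish where g does allows h to be divided by a power of the weight when the lemma is
    applied. *)
Lemma lorentz_norm_dual_le (p : R) (r : \bar R) (B : R) :
  (1 < p)%R -> 1 <= r -> (0 < B)%R ->
  (forall h : T -> R, measurable_fun [set: T] h -> (forall x, 0 <= h x)%R ->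
    (forall x, g x = 0 -> h x = 0)%R ->
    lorentz_norm mu p r (EFin \o h) < +oo ->
    forall J, J%:E <= \int[mu]_x (h x * g x)%:E ->
      J%:E <= B%:E * lorentz_norm mu p r (EFin \o h)) ->
  lorentz_norm mu (p / (p - 1)) (hoelder_conjugate r) (EFin \o g) <= (8 * B)%:E.
Proof.
move=> p1 r1 B0 gB; have p0 : (0 < p)%R by exact: lt_trans p1.
set q := (p / (p - 1))%R.
have q0 : (0 < q)%R by rewrite divr_gt0// subr_gt0.
have qE : (q^-1 = 1 - p^-1)%R by rewrite /q; field; rewrite !gt_eqF// subr_gt0.
(* The factor 2 is the 1/2 lost in the lower bound for the pairing. *)
have key (c : R) (a : nat -> R) n N : (0 < c)%R -> (forall i, 0 <= a i)%R ->
    lorentz_norm mu p r (EFin \o test_fun (fun i => c * 2 ^+ i)%R a n) <= N%:E ->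
    (\sum_(0 <= i < n) c * 2 ^+ i * a i * dist (c * 2 ^+ i) <= 2 * B * N)%R.
  move=> c0 a0 hN.
  rewrite -mulrA -ler_pdivrMl// mulrC -lee_fin [leRHS]EFinM.
  apply: le_trans (lee_wpmul2l _ hN); last by rewrite lee_fin ltW.
  apply: gB; last exact: integral_test_fun.
  - exact: measurable_test_fun.
  - by move=> x; exact: level_max_ge0.
  - by move=> x; apply: test_fun_eq0 => i; rewrite mulr_gt0 ?exprn_gt0.
  - by rewrite (le_lt_trans hN)// ltry.
have lam0 (c : R) i : (0 < c)%R -> (0 < c * 2 ^+ i :> R)%R.
  by move=> c0; rewrite mulr_gt0 ?exprn_gt0.
have lam_homo (c : R) : (0 < c)%R ->
    {homo (fun i => c * 2 ^+ i)%R : i j / (i <= j)%N >-> (i <= j)%R}.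
  by move=> c0 i j ij; rewrite ler_pM2l// ler_weXn2l// ler1n.
case: r r1 gB key => [r| |//] r1 _ key.
- have r0 : (0 < r)%R by rewrite (lt_le_trans ltr01).
  have [r_eq1|r_neq1] := eqVneq r 1%R.
    rewrite r_eq1 hoelder_conjugate1.
    apply: (@le_trans _ _ (2 * B)%:E); last by rewrite lee_fin ler_pM2r// ler_nat.
    apply: lorentz_normy_dyadic_le => // c c0.
    (* For r = 1 a single level suffices: h is the indicator of {g > c}, of norm at most |{g >
       c}|^(1/p). *)
    have := key c (fun=> 1%R) 1%N _ c0 (fun=> ler01) (lorentz_norm_test_fun 1
      (fun i => lam0 c i c0) (lam_homo c c0) (fun=> ler01) p0 r0).
    rewrite r_eq1 !big_nat1 expr0 !mulr1 invr1 !powRr1 ?mulr_ge0 ?powR_ge0// !mul1r => h.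
    have [->|d_neq0] := eqVneq (dist c) 0%R.
      by rewrite powR0 ?mulr0 ?mulr_ge0 ?ltW// invr_eq0 gt_eqF.
    have d0 : (0 < dist c)%R by rewrite lt0r d_neq0 dist_ge0.
    rewrite -(@ler_pM2r _ (dist c `^ p^-1)) ?powR_gt0// -mulrA -powRD; last first.
      by rewrite d_neq0 implybT.
    by rewrite qE subrK powRr1.
  have r_gt1 : (1 < r)%R by rewrite lt_neqAle eq_sym r_neq1.
  set s := (r / (r - 1))%R.
  have -> : hoelder_conjugate r%:E = s%:E.
    rewrite /hoelder_conjugate /= eqe gt_eqF//= inver subr_eq0 (negbTE r_neq1).
    by rewrite -EFinM.
  have s1 : (1 <= s)%R by rewrite ler_pdivlMr ?subr_gt0// mul1r gerBl.
  have s0 : (0 < s)%R by exact: lt_le_trans s1.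
  apply: lorentz_norm_fin_dyadic_le => // c n c0.
  (* The identities (s - 1) r = s and (s / q - 1) r + r / p = s / q make the sum from the pairing
     and the sum from the norm coincide. *)
  pose a i := ((c * 2 ^+ i) `^ (s - 1) * dist (c * 2 ^+ i) `^ (s / q - 1))%R.
  have a0 i : (0 <= a i)%R by rewrite mulr_ge0 ?powR_ge0.
  have := key _ _ _ _ c0 a0 (lorentz_norm_test_fun n
    (fun i => lam0 c i c0) (lam_homo c c0) a0 p0 r0).
  have sq0 : (s / q != 0)%R by rewrite gt_eqF// divr_gt0.
  under eq_bigr => i _.
    have -> : (c * 2 ^+ i * a i * dist (c * 2 ^+ i) =
        (c * 2 ^+ i) `^ s * dist (c * 2 ^+ i) `^ (s / q))%R.
      rewrite /a; have l0 := lam0 c i c0; set l := (c * 2 ^+ i)%R in l0 *.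
      rewrite mulrA -{1}[l]powRr1 ?ltW// -powRD ?(gt_eqF l0) ?implybT//.
      rewrite (addrC 1%R) subrK -mulrA; congr (_ * _)%R.
      have [->|d0] := eqVneq (dist l) 0%R; first by rewrite mulr0 powR0.
      by rewrite -{2}[dist l]powRr1// -powRD ?d0 ?implybT// subrK.
    over.
  under [X in (_ <= _ * X `^ _)%R -> _]eq_bigr => i _.
    have -> : (a i `^ r * dist (c * 2 ^+ i) `^ (r / p) =
        (c * 2 ^+ i) `^ s * dist (c * 2 ^+ i) `^ (s / q))%R.
      rewrite /a powRM ?powR_ge0// -!powRrM -mulrA.
      have -> : ((s - 1) * r = s)%R by rewrite /s; field; rewrite gt_eqF// subr_gt0.
      congr (_ * _)%R.
      have [->|d0] := eqVneq (dist (c * 2 ^+ i)) 0%R.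
        by rewrite [X in (_ * X)%R]powR0 ?mulr0 ?powR0// gt_eqF// divr_gt0.
      rewrite -powRD ?d0 ?implybT//; congr (_ `^ _)%R.
      by rewrite qE /s; field; rewrite !gt_eqF// subr_gt0.
    over.
  (* Now S <= 2 B S^(1/r). Dividing by S^(1/r) when S > 0 leaves S^(1/s) <= 2 B. *)
  set S := (\sum_(_ <= _ < _) _)%R => SB.
  have S0 : (0 <= S)%R by apply: sumr_ge0 => i _; rewrite mulr_ge0 ?powR_ge0.
  have [->|S_neq0] := eqVneq S 0%R; first exact: powR_ge0.
  have -> : S = ((S `^ s^-1) `^ s)%R.
    by rewrite -powRrM mulVf ?gt_eqF// powRr1.
  apply: ge0_ler_powR; rewrite ?nnegrE ?(ltW s0) ?powR_ge0 ?mulr_ge0 ?(ltW B0)//.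
  have Sp : (0 < S)%R by rewrite lt0r S_neq0.
  rewrite -(@ler_pM2r _ (S `^ r^-1)) ?powR_gt0// -powRD ?S_neq0 ?implybT//.
  have -> : (s^-1 + r^-1 = 1)%R by rewrite /s; field; rewrite !gt_eqF// subr_gt0.
  by rewrite powRr1.
- rewrite hoelder_conjugatey.
  apply: lorentz_norm_fin_dyadic_le => // c n c0.
  (* The same choice of a_i with conjugate exponent 1; it normalizes the test function to norm at
     most 1. *)
  pose a i := (dist (c * 2 ^+ i) `^ (- p^-1))%R.
  have a0 i : (0 <= a i)%R by exact: powR_ge0.
  (* Exponents add only on a nonzero base. On null level sets both sides of the later comparisons
     vanish, as [powR] sends 0 to 0 for a nonzero exponent. *)
  have aE i e : (e != 0)%R ->
      (a i * dist (c * 2 ^+ i) `^ e = dist (c * 2 ^+ i) `^ (e - p^-1))%R \/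
      dist (c * 2 ^+ i) = 0%R.
    move=> e0; have [->|d0] := eqVneq (dist (c * 2 ^+ i)) 0%R; first by right.
    by left; rewrite /a -powRD ?d0 ?implybT// addrC.
  have aA i : (i < n)%N -> (a i * dist (c * 2 ^+ i) `^ p^-1 <= 1)%R.
    move=> _; have p_neq0 : (p^-1 != 0)%R by rewrite invr_eq0 gt_eqF.
    by have [->|->] := aE i _ p_neq0; rewrite ?subrr ?powRr0 ?powR0 ?mulr0.
  have := key _ _ _ _ c0 a0 (lorentz_normy_test_fun
    (fun i => lam0 c i c0) (lam_homo c c0) a0 p0 ler01 aA).
  rewrite mulr1 powRr1 ?mulr_ge0 ?(ltW B0)//; apply: le_trans.
  apply: ler_sum => i _; rewrite powRr1 ?(ltW (lam0 _ _ c0))// -[leRHS]mulrA ler_pM2l ?lam0//.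
  have := aE i 1%R (oner_neq0 _); rewrite powRr1// => -[->|->]; first by rewrite mul1r qE.
  by rewrite mulr0 powR0// mul1r invr_eq0 gt_eqF.
Qed.

End duality.

(** * Measure of cubes and lower bounds for the two operators *)

Section cubes.
Context {R : realType} {d : nat}.
Local Notation mu := (lebesgue R d).

Definition cube_at (c : d.-tuple R) (l : R) : set (euclid R d) :=
  [set x | forall i, (tnth c i <= tnth x i <= tnth c i + l)%R].

Let side (c : d.-tuple R) (l : R) (i : 'I_d) : set (measurableTypeR R) :=
  [set` `[tnth c i, (tnth c i + l)%R]].

Let cube_atE c l : cube_at c l =
  [set x : d.-tuple (measurableTypeR R) | forall i, side c l i (tnth x i)].
Proof.
by apply/seteqP; split => x /= cx i; have := cx i; rewrite /side/= in_itv.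
Qed.

Let measurable_box c l : measurable
  [set x : d.-tuple (measurableTypeR R) | forall i, side c l i (tnth x i)].
Proof.
rewrite (_ : [set x | _] = \bigcap_(i in [set: 'I_d])
    ((fun x : d.-tuple (measurableTypeR R) => tnth x i) @^-1` side c l i)).
  apply: fin_bigcap_measurable => // i _.
  rewrite -[X in measurable X]setTI; apply: measurable_tnth => //.
  exact: measurable_itv.
by apply/seteqP; split => x /= h i; [move=> _; exact: h|exact: (h i I)].
Qed.

Lemma measurable_cube_at c l : measurable (cube_at c l).
Proof.
rewrite cube_atE; apply: sub_caratheodory; apply: sub_sigma_algebra.
exact: measurable_box.
Qed.

(** A cube is a Borel box, where the completed measure agrees with the product measure, a product of
    d side lengths. *)
Lemma lebesgue_cube_at c l : (0 < l)%R -> mu (cube_at c l) = (l ^+ d)%:E.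
Proof.
move=> l0; rewrite /lebesgue /completed_measure_extension cube_atE.
apply: etrans (measurable_mu_extE _ (measurable_box c l)) _.
apply: etrans (lebesgue_prod_box (A := side c l) _) _.
  by move=> i; exact: measurable_itv.
rewrite (eq_bigr (fun=> l%:E)) => [|i _].
  by rewrite prodEFin prodr_const card_ord.
by rewrite /side lebesgue_measure_itv/= lte_fin ltrDl l0 -EFinD addrAC subrr add0r.
Qed.

(** The cube itself competes in the supremum, with factor |Q|^(alpha/d - 1) = l^(alpha - d). *)
Lemma frac_maximal_ge (alpha : R) c l (F : euclid R d -> \bar R) (J : R) x :
  (0 < l)%R -> (0 < d)%N -> (forall y, 0 <= F y) ->
  (forall y, ~ cube_at c l y -> F y = 0) ->
  J%:E <= \int[mu]_y F y -> cube_at c l x ->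
  (l `^ (alpha - d%:R) * J)%:E <= frac_maximal alpha F x.
Proof.
move=> l0 d0 F0 FQ JF Qx; have M0 : (0 < l ^+ d :> R)%R by exact: exprn_gt0.
apply: le_ereal_sup_tmp; exists (mu (cube_at c l) `^ (alpha / d%:R) *
    ((mu (cube_at c l))^-1 * \int[mu]_(y in cube_at c l) `|F y|)).
  by exists (cube_at c l) => //; split => //; exists c, l.
have -> : \int[mu]_(y in cube_at c l) `|F y| = \int[mu]_y F y.
  rewrite integral_mkcond; apply: eq_integral => y _; rewrite patchE.
  by case: ifPn => [_|/negP]; [rewrite gee0_abs|rewrite inE => /FQ ->].
rewrite lebesgue_cube_at// inver gt_eqF// poweR_EFin muleA -EFinM.
have -> : ((l ^+ d) `^ (alpha / d%:R) / l ^+ d = l `^ (alpha - d%:R))%R.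
  rewrite -powR_mulrn ?ltW// -powRrM (mulrC d%:R) divfK ?pnatr_eq0 ?gtn_eqF//.
  by rewrite -powRB// (gt_eqF l0) implybT.
by rewrite EFinM lee_wpmul2l// lee_fin powR_ge0.
Qed.

Lemma euclid_dist_le c l x y : (0 <= l)%R -> cube_at c l x -> cube_at c l y ->
  (euclid_dist x y <= Num.sqrt d%:R * l)%R.
Proof.
move=> l0 Qx Qy; rewrite /euclid_dist -[X in (_ * X)%R](ger0_norm l0) -sqrtr_sqr.
rewrite -sqrtrM// ler_sqrt ?mulr_ge0 ?sqr_ge0//.
rewrite mulr_natl -[X in (_ *+ X)%R](card_ord d) -sumr_const; apply: ler_sum => i _.
rewrite -[leLHS]real_normK ?num_real// lerXn2r ?nnegrE//.
have /andP[x1 x2] := Qx i; have /andP[y1 y2] := Qy i.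
by rewrite ler_norml; apply/andP; split; lra.
Qed.

(** Two points of the cube are at distance at most sqrt(d) l, and alpha < d makes the kernel
    decrease with the distance, so on the cube it is at least (sqrt(d) l)^(alpha - d). *)
Lemma frac_integral_ge (alpha : R) c l (F : euclid R d -> \bar R) (J : R) x :
  (0 < l)%R -> (0 < d)%N -> (alpha < d%:R)%R ->
  measurable_fun [set: euclid R d] F -> (forall y, 0 <= F y) ->
  (forall y, ~ cube_at c l y -> F y = 0) ->
  J%:E <= \int[mu]_y F y -> cube_at c l x ->
  (Num.sqrt d%:R `^ (alpha - d%:R) * l `^ (alpha - d%:R) * J)%:E <=
    frac_integral alpha F x.
Proof.
move=> l0 d0 ad mF F0 FQ JF Qx.
have sd0 : (0 < Num.sqrt d%:R :> R)%R by rewrite sqrtr_gt0 ltr0n.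
have ad0 : (0 < d%:R - alpha)%R by rewrite subr_gt0.
set k := (_ * l `^ _)%R.
have kE : k = ((Num.sqrt d%:R * l) `^ (d%:R - alpha))^-1%R.
  by rewrite -powRN opprB powRM ?ltW.
have k0 : (0 <= k)%R by rewrite kE invr_ge0 powR_ge0.
apply: (@le_trans _ _ (\int[mu]_y (k%:E * F y))).
  rewrite ge0_integralZl_EFin//.
  by rewrite EFinM lee_wpmul2l.
apply: ge0_le_integralW => y; first by rewrite mule_ge0.
have [Qy|/FQ ->] := pselect (cube_at c l y); last by rewrite mule0 mul0e.
rewrite muleC; apply: lee_wpmul2l => //; rewrite inver; case: ifPn => [_|D0].
  (* The diagonal y = x, where the kernel takes the value 1 / 0 = +oo. *)
  by rewrite leey.
have D_gt0 : (0 < euclid_dist x y `^ (d%:R - alpha))%R by rewrite lt0r D0 powR_ge0.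
rewrite lee_fin kE lef_pV2 ?posrE ?D_gt0 ?(powR_gt0 _ (mulr_gt0 sd0 l0))//.
apply: ge0_ler_powR; rewrite ?nnegrE ?sqrtr_ge0 ?mulr_ge0 ?(ltW l0) ?(ltW ad0)//.
exact: (euclid_dist_le (ltW l0) Qx Qy).
Qed.

End cubes.

(** * From boundedness to the weight class *)

Section two_weight.
Context {R : realType} {d : nat}.
Local Notation mu := (lebesgue R d).
Implicit Types (u sigma : euclid R d -> \bar R).

(** Both operators enter only through their lower bound on cubes, with k = 1 for the maximal
    operator and k = sqrt(d)^(alpha - d) for the fractional integral. The supremum is at most 8 (C +
    1) / k. *)
Lemma weight_class_of_bounded (Op : (euclid R d -> \bar R) -> euclid R d -> \bar R)
    (alpha p q k : R) (r s : \bar R) u sigma :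
  (0 < d)%N -> (0 < k)%R -> (1 < p)%R -> (0 < q)%R -> 1 <= r -> 1 <= s ->
  weight u -> weight sigma ->
  (forall c l F J x, (0 < l)%R ->
    measurable_fun [set: euclid R d] F -> (forall y, 0 <= F y) ->
    (forall y, ~ cube_at c l y -> F y = 0) ->
    J%:E <= \int[mu]_y F y -> cube_at c l x ->
    (k * l `^ (alpha - d%:R) * J)%:E <= Op F x) ->
  lorentz_bounded mu (fun f => Op (fun x => f x * sigma x))
    p r (fun x => sigma x `^ p^-1) q s (fun x => u x `^ q^-1) ->
  weight_class alpha p r q s u sigma.
Proof.
move=> d0 k0 p1 q0 r1 s1 [mU _] [ms ws] OpQ [C C0 bnd].
have p0 : (0 < p)%R by exact: lt_trans p1.
have s0 : 0 < s by exact: lt_le_trans s1.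
rewrite /weight_class.
have -> : fine (hoelder_conjugate p%:E) = (p / (p - 1))%R.
  by rewrite /hoelder_conjugate /= eqe gt_eqF//= inver subr_eq0 gt_eqF.
set p' := (p / (p - 1))%R.
have p'0 : (0 < p')%R by rewrite divr_gt0// subr_gt0.
have p'E : (p'^-1 = 1 - p^-1)%R by rewrite /p'; field; rewrite !gt_eqF// subr_gt0.
apply: (@le_lt_trans _ _ (8 * (C + 1) / k)%:E); last exact: ltry.
apply/ereal_supP => _ [_ [c [l [l0 ->]]] <-].
rewrite -/(cube_at c l) /lorentz_norm_on lebesgue_cube_at//.
set Q := cube_at c l; set U := lorentz_norm _ q s _; set G := lorentz_norm _ p' _ _.
have mQ : measurable Q by exact: measurable_cube_at.
have mpow := fun (v : euclid R d -> \bar R) e mv => measurable_poweR_indic e mv mQ.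
have M0 : (0 < l ^+ d :> R)%R by exact: exprn_gt0.
set m := (l `^ (alpha - d%:R))%R; have m0 : (0 < m)%R by exact: powR_gt0.
(* The exponents of |Q| add up to alpha/d + 1/q - 1/p - 1/q - 1/p' = alpha/d - 1. *)
have -> : (l ^+ d)%:E `^ (alpha / d%:R + q^-1 - p^-1) * ((l ^+ d)%:E `^ (- q^-1) * U) *
    ((l ^+ d)%:E `^ (- p'^-1) * G) = m%:E * (U * G).
  rewrite !poweR_EFin -!muleA (muleCA U) !muleA -!EFinM -!muleA; congr (_%:E * _).
  rewrite -!powRD ?(gt_eqF M0) ?implybT// p'E.
  rewrite -powR_mulrn ?(ltW l0)// -powRrM; congr (_ `^ _)%R.
  by field; rewrite pnatr_eq0 gtn_eqF// !gt_eqF.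
(* [U] may be infinite a priori, so it is replaced by a real minorant rho. *)
rewrite -lee_pdivlMl// -EFinM; apply: mule_le_fin_approx; rewrite ?lorentz_norm_ge0//.
  by rewrite mulr_ge0 ?invr_ge0 ?divr_ge0 ?mulr_ge0 ?addr_ge0// ltW.
move=> rho rho0 rhoU.
(* Chosen so that k m rho J <= (C + 1) N, with N the norm of the test function, becomes J <= B N; C
   + 1 keeps B positive when C = 0. *)
pose B := ((C + 1) / (k * m * rho))%R.
have B0 : (0 < B)%R by rewrite divr_gt0 ?mulr_gt0// ltr_wpDl.
suff GB : G <= (8 * B)%:E.
  apply: le_trans (lee_wpmul2l _ GB) _; first by rewrite lee_fin ltW.
  rewrite -EFinM lee_fin le_eqVlt; apply/orP; left; apply/eqP.
  by rewrite /B; field; rewrite !gt_eqF.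
(* Cutting down to the set where sigma is positive and finite gives a real-valued g, as the duality
   lemma requires, and discards only a null set. *)
pose W := [set x : euclid R d | 0 < sigma x < +oo].
have mW : measurable W.
  rewrite (_ : W = [set x | 0 < sigma x] `&` [set x | sigma x < +oo]); last first.
    by apply/seteqP; split => x /=; [move=> /andP[]|move=> [? ?]; apply/andP].
  apply: measurableI; rewrite -[X in measurable X]setTI.
    exact: emeasurable_fun_o_infty.
  exact: emeasurable_fun_infty_o.
have W0 : mu (~` W) = 0 by apply: measure_negligible; [exact: measurableC|exact: ws].
pose D := Q `&` W; have mD : measurable D by exact: measurableI.
pose g x := (fine (sigma x) `^ p'^-1 * \1_D x)%R.
have gD x : D x -> (g x)%:E = sigma x `^ p'^-1.
  move=> Dx; rewrite /g indicE mem_set// mulr1.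
  by case: Dx => _ /andP[]; case: (sigma x).
have gND x : ~ D x -> g x = 0%R.
  by move=> Dx; rewrite /g indicE memNset// mulr0.
have mg : measurable_fun [set: euclid R d] g.
  apply: measurable_funM; last exact: measurable_indic.
  exact: (measurableT_comp (measurable_powR _) (measurableT_comp (fine_measurable _) ms)).
have g0 x : (0 <= g x)%R by rewrite mulr_ge0 ?powR_ge0// indicE.
have g_gt0 x : (0 < g x)%R -> D x by move=> gx; apply: contrapT => /gND gx0; rewrite gx0 ltxx in gx.
have mgl l' : measurable [set x | (l' < g x)%R].
  rewrite -[X in measurable X]setTI (_ : [set x | _] = g @^-1` `]l', +oo[).
    by apply: mg => //; exact: measurable_itv.
  by apply/seteqP; split => x /=; rewrite in_itv/= andbT.
have goo : mu [set x | (0 < g x)%R] < +oo.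
  apply: (@le_lt_trans _ _ (mu Q)); last by rewrite lebesgue_cube_at// ltry.
  by apply: le_measure; [rewrite inE..|move=> x /= /g_gt0[]].
(* The level sets of the two functions differ only inside the null complement of [W]. *)
apply: (@le_trans _ _ (lorentz_norm mu p' (hoelder_conjugate r) (EFin \o g))).
  apply: lorentz_norm_le => //; first exact: lt_le_trans (hoelder_conj_ge1 r1).
  move=> t t0; rewrite (_ : [set x | _ < `|(EFin \o g) x|] = [set x | (t < g x)%R]); last first.
    by apply/funext => x /=; rewrite lte_fin ger0_norm.
  apply: (@le_trans _ _ (mu ([set x | (t < g x)%R] `|` ~` W))); last first.
    rewrite -[leRHS]adde0 -W0; apply: measureU2 => //; exact: measurableC.
  apply: le_measure.
  - by rewrite inE; apply: measurable_abs_level; exact: mpow.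
  - by rewrite inE; apply: measurableU => //; exact: measurableC.
  - move=> x /=; have [Wx|] := pselect (W x); last by right.
    rewrite indicE; case: (boolP (x \in Q)) => [|_]; last first.
      by rewrite mule0 abse0 lte_fin ltNge t0.
    rewrite inE => Qx; rewrite mule1 gee0_abs ?poweR_ge0// -gD ?lte_fin//.
    by left.
apply: (lorentz_norm_dual_le mg g0 goo p1 r1 B0) => h mh h0 hg hoo J hJ.
set N := lorentz_norm _ _ _ _ in hoo *.
have N0 : 0 <= N by exact: lorentz_norm_ge0.
have [J0|J0] := leP J 0%R.
  by rewrite (@le_trans _ _ 0)// ?lee_fin// mule_ge0// lee_fin ltW.
(* The function f with f sigma^(1/p) = h, hence f sigma = h g. *)
pose f x := (h x)%:E * sigma x `^ (- p^-1).
have hD x : ~ D x -> h x = 0%R by move=> /gND; exact: hg.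
have fW x : f x * sigma x `^ p^-1 = (h x)%:E.
  have [[_ /andP[]]|/hD hx] := pselect (D x); last by rewrite /f hx !mul0e.
  rewrite /f; case: (sigma x) => [y|//|//]; rewrite lte_fin => y0 _.
  by rewrite !poweR_EFin -!EFinM -mulrA -powRD ?(gt_eqF y0) ?implybT// addNr powRr0 mulr1.
have fS x : f x * sigma x = (h x * g x)%:E.
  have [Dx|/hD hx] := pselect (D x); last by rewrite /f hx !mul0e mul0r.
  rewrite EFinM gD// /f -muleA; congr (_ * _).
  case: Dx => _ /andP[]; case: (sigma x) => [y|//|//]; rewrite lte_fin => y0 _.
  rewrite !poweR_EFin -EFinM -[X in (_ * X)%R](powRr1 (ltW y0)) -powRD ?(gt_eqF y0) ?implybT//.
  by rewrite p'E addrC.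
have ff : (fun x => f x * sigma x `^ p^-1) = EFin \o h by apply/funext.
have fs : (fun x => f x * sigma x) = (fun x => (h x * g x)%:E) by apply/funext.
have [|[mOp _]] := bnd f.
  change (lorentz mu p r (fun x => f x * sigma x `^ p^-1)); rewrite ff.
  by split; [exact/measurable_EFinP|exact: hoo].
rewrite /wlorentz_norm ff fs -/N in mOp * => OpN.
pose kap := (k * m * J)%R; have kap0 : (0 < kap)%R by rewrite !mulr_gt0.
have OpF x : Q x -> kap%:E <= Op (fun x => (h x * g x)%:E) x.
  move=> Qx; apply: (OpQ c l _ J x l0 _ _ _ hJ Qx).
  - by apply/measurable_EFinP; exact: measurable_funM.
  - by move=> y; rewrite lee_fin mulr_ge0.
  - by move=> y Qy; rewrite hD ?mul0r// => -[].
(* On [Q] the image of f is at least [kap], so after multiplication by u^(1/q) its level sets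
   contain those of [kap] times u^(1/q) on [Q]. *)
have : kap%:E * U <= C%:E * N.
  apply: le_trans OpN; apply: le_trans (lorentz_normZ_le _ _ q0 s0 kap0) _.
  apply: lorentz_norm_le => // t t0; apply: le_measure.
  - rewrite inE; apply: measurable_abs_level; apply: measurable_funeM; exact: mpow.
  - by rewrite inE; exact: measurable_abs_level.
  - move=> x /= /lt_le_trans; apply; rewrite indicE.
    case: (boolP (x \in Q)) => [|_]; last by rewrite !mule0 abse0.
    rewrite inE => /OpF xQ; have Op0 := le_trans (ltW kap0 : 0 <= kap%:E) xQ.
    rewrite mule1 !gee0_abs ?mule_ge0 ?poweR_ge0 ?lee_fin ?(ltW kap0)//.
    by rewrite lee_wpmul2r ?poweR_ge0.
move=> UN; rewrite /B mulrC EFinM -muleA lee_pdivlMl ?mulr_gt0// -EFinM.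
rewrite (@le_trans _ _ (C%:E * N))//; last first.
  by rewrite lee_wpmul2r// lee_fin lerDl.
apply: le_trans UN; have -> : (k * m * rho * J = kap * rho)%R by rewrite /kap; ring.
by rewrite EFinM lee_wpmul2l// lee_fin ltW.
Qed.

End two_weight.

Theorem corollary3p3 (R : realType) (d : nat) (alpha p q : R) (r s : \bar R)
    (u sigma : euclid R d -> \bar R) :
  (0 <= alpha)%R -> (alpha < d%:R)%R -> (1 < p)%R -> (p <= q)%R ->
  1 <= r -> 1 <= s -> weight u -> weight sigma ->
  (lorentz_bounded (lebesgue R d)
     (fun f => frac_maximal alpha (fun x => f x * sigma x))
     p r (fun x => sigma x `^ p^-1) q s (fun x => u x `^ q^-1) ->
   weight_class alpha p r q s u sigma) /\
  ((0 < alpha)%R ->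
   lorentz_bounded (lebesgue R d)
     (fun f => frac_integral alpha (fun x => f x * sigma x))
     p r (fun x => sigma x `^ p^-1) q s (fun x => u x `^ q^-1) ->
   weight_class alpha p r q s u sigma).
Proof.
move=> a0 ad p1 pq r1 s1 wu wsigma.
have d0 : (0 < d)%N by rewrite -(ltr0n R); exact: le_lt_trans ad.
have q0 : (0 < q)%R by rewrite (lt_le_trans _ pq)// (lt_trans _ p1).
split=> [|_].
  apply: (weight_class_of_bounded (k := 1%R)) => // c l F J x l0 _ F0 FQ JF Qx.
  by rewrite mul1r; exact: (frac_maximal_ge alpha l0 d0 F0 FQ JF Qx).
apply: (weight_class_of_bounded
  (k := (Num.sqrt d%:R `^ (alpha - d%:R))%R)) => // [|c l F J x l0 mF F0 FQ JF Qx].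
  by rewrite powR_gt0// sqrtr_gt0 ltr0n.
exact: (frac_integral_ge l0 d0 ad mF F0 FQ JF Qx).
Qed.
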